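(* A graph $G=(V,E)$ belongs to $\textsc{And}(1)$ if and only if there exists a total ordering $<_\pi$ of $V$ satisfying the four point condition: for all vertices $x,u,v,y$ with $x<_\pi u<_\pi v<_\pi y$ and $xv\in E$, $uy\in E$, we have $uv\in E$.
   Context: All graphs are finite, simple and connected. An $\textsc{And}(1)$-realization of a graph $G=(V,E)$ is a family $\{([L(v),R(v)],p_v):v\in V\}$ of closed real intervals $[L(v),R(v)]$ and points $p_v\in[L(v),R(v)]$ such that for all distinct $u,v\in V$: $uv\in E$ iff $p_v\in[L(u),R(u)]$ and $p_u\in[L(v),R(v)]$. $\textsc{And}(1)$ is the class of graphs admitting an $\textsc{And}(1)$-realization. *)

(* Defs.v *)
(* Graphs are symmetric irreflexive relations on a finType; the real line is an
   arbitrary realType. *)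
From HB Require Import structures.
From mathcomp Require Import all_boot all_order all_algebra.
From mathcomp Require Import reals.

Set Implicit Arguments.
Unset Strict Implicit.
Unset Printing Implicit Defensive.

Import Order.TTheory GRing.Theory Num.Theory.
Local Open Scope ring_scope.

Definition connected_graph (V : finType) (e : rel V) : Prop :=
  forall x y : V, connect e x y.

(* lo and hi are the endpoint maps L and R; lo v <= hi v follows from the
   first clause. *)
Definition and1_realization (R : realType) (V : finType) (e : rel V)
    (lo hi p : V -> R) : Prop :=
  (forall v, p v \in `[lo v, hi v]) /\
  (forall u v, u != v ->
     (e u v <-> p v \in `[lo u, hi u] /\ p u \in `[lo v, hi v])).

Definition in_And1 (R : realType) (V : finType) (e : rel V) : Prop :=
  exists lo hi p : V -> R, and1_realization e lo hi p.

(* Strict form, as for <%O. *)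
Definition strict_total_order (V : finType) (lt : rel V) : Prop :=
  [/\ irreflexive lt, transitive lt &
      forall x y, x != y -> lt x y \/ lt y x].

Definition four_point_condition (V : finType) (e lt : rel V) : Prop :=
  forall x u v y,
    lt x u -> lt u v -> lt v y -> e x v -> e u y -> e u v.

(* Main.v *)
(** In a realization, order the vertices by their points: if x < u < v < y, then
    xv in E puts p u between p x and p v, hence in I v, and uy in E puts p v in
    I u. Conversely, take as point of v its rank in the order and as interval
    the hull of the closed neighbourhood of v. If u < v are not adjacent but see
    each other's points, then u has a neighbour y > v and v has a neighbour
    x < u, which contradicts the four point condition. *)
Require Import Defs.
From HB Require Import structures.
From mathcomp Require Import all_boot all_order all_algebra.
From mathcomp Require Import reals.

Set Implicit Arguments.
Unset Strict Implicit.
Unset Printing Implicit Defensive.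

Import Order.TTheory GRing.Theory Num.Theory.

Section OrderOfRealization.
Variables (R : realType) (V : finType) (e : rel V).

(* Equal points are ordered by [enum_rank]; any tie-breaking rule would do. *)
Definition point_key (p : V -> R) (v : V) : R *l 'I_#|V| := (p v, enum_rank v).

Lemma point_key_inj p : injective (point_key p).
Proof. by move=> u v [_ /enum_rank_inj]. Qed.

(** Keys may differ in the tie-break alone, so only the weak inequality survives; for closed
    intervals that is enough. *)
Lemma point_key_lt_le p u v :
  (point_key p u < point_key p v)%O -> (p u <= p v)%R.
Proof. by move/ltW; rewrite Order.ProdLexiOrder.lexi_pair => /andP[]. Qed.

Lemma key_strict_total_order d (T : orderType d) (f : V -> T) :
  injective f -> strict_total_order (fun u v => (f u < f v)%O).
Proof.
move=> f_inj; split=> [v|v u w|u v neq_uv]; first exact: ltxx.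
  exact: lt_trans.
by apply/orP/lt_total; rewrite (inj_eq f_inj).
Qed.

Lemma realization_four_point lo hi p : and1_realization e lo hi p ->
  four_point_condition e (fun u v => (point_key p u < point_key p v)%O).
Proof.
case=> p_in eP x u v y xu uv vy exv euy.
have nxv : x != v by apply: contraTneq (lt_trans xu uv) => ->; rewrite ltxx.
have nuy : u != y by apply: contraTneq (lt_trans uv vy) => ->; rewrite ltxx.
have nuv : u != v by apply: contraTneq uv => ->; rewrite ltxx.
(* The edge xv gives [lo v <= p x]; the edge uy then gives [p y <= hi u]. *)
move: ((eP _ _ nxv).1 exv); rewrite !in_itv /= => -[_ /andP[lo_x _]].
move: ((eP _ _ nuy).1 euy); rewrite !in_itv /= => -[/andP[_ hi_y] _].
move: (p_in u); rewrite !in_itv /= => /andP[lo_u _].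
move: (p_in v); rewrite !in_itv /= => /andP[_ hi_v].
have le_xu := point_key_lt_le xu.
have le_uv := point_key_lt_le uv.
have le_vy := point_key_lt_le vy.
apply: (eP _ _ nuv).2; rewrite !in_itv /=; split; apply/andP; split.
- exact: le_trans lo_u le_uv.
- exact: le_trans le_vy hi_y.
- exact: le_trans lo_x le_xu.
- exact: le_trans le_uv hi_v.
Qed.

End OrderOfRealization.

Section RealizationOfOrder.
Variables (R : realType) (V : finType) (e lt : rel V).

Definition order_rank (v : V) : nat := #|[pred u | lt u v]|.

(** Including [v] itself makes the extrema below exist and puts the point of [v] in its interval. *)
Definition closed_nbr (v w : V) : bool := (w == v) || e v w.

(** Endpoints are kept as vertices, not ranks, so that they can serve as x and y in the four point
    condition. *)
Definition lo_nbr v : V := [arg min_(w < v | closed_nbr v w) order_rank w].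
Definition hi_nbr v : V := [arg max_(w > v | closed_nbr v w) order_rank w].

Lemma closed_nbr_refl v : closed_nbr v v.
Proof. by rewrite /closed_nbr eqxx. Qed.

Lemma in_nbr_hull v w : closed_nbr v w ->
  order_rank (lo_nbr v) <= order_rank w <= order_rank (hi_nbr v).
Proof.
move=> vw; rewrite /lo_nbr /hi_nbr.
case: arg_minnP => [|l _ ->//]; first exact: closed_nbr_refl.
by case: arg_maxnP => [|h _]; [exact: closed_nbr_refl | apply].
Qed.

Hypothesis lt_sto : strict_total_order lt.

Lemma order_rank_lt u v : lt u v -> order_rank u < order_rank v.
Proof.
case: lt_sto => lt_irr lt_tr _ uv; apply: proper_card; apply/properP.
(* The inclusion of predecessor sets is strict: [u] precedes [v] but not itself. *)
split; last by exists u; rewrite !inE ?lt_irr.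
by apply/subsetP => w; rewrite !inE => /lt_tr; apply.
Qed.

Lemma order_rank_le u v : order_rank u <= order_rank v -> u = v \/ lt u v.
Proof.
case: lt_sto => _ _ lt_tot le_uv; have [->|/lt_tot[]] := eqVneq u v; auto.
by move/order_rank_lt; rewrite ltnNge le_uv.
Qed.

Hypotheses (e_sym : symmetric e) (e4 : four_point_condition e lt).

Lemma four_point_hull_adj u v : lt u v ->
  order_rank v <= order_rank (hi_nbr u) ->
  order_rank (lo_nbr v) <= order_rank u -> e u v.
Proof.
move=> uv; rewrite /hi_nbr /lo_nbr.
case: arg_maxnP => [|y /= y_nbr _ le_vy]; first exact: closed_nbr_refl.
case: arg_minnP => [|x /= x_nbr _ le_xu]; first exact: closed_nbr_refl.
have rank_uv := order_rank_lt uv.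
(* The case y = u is excluded, as y ranks at least as high as v, hence above u. *)
have euy : e u y.
  case/predU1P: y_nbr => // eq_yu.
  by move: le_vy; rewrite eq_yu leqNgt rank_uv.
have evx : e v x.
  case/predU1P: x_nbr => // eq_xv.
  by move: le_xu; rewrite eq_xv leqNgt rank_uv.
(* If y = v or x = u, the edge just found is already uv; otherwise x < u < v < y. *)
case: (order_rank_le le_vy) => [->//|vy].
case: (order_rank_le le_xu) => [<-|xu]; first by rewrite e_sym.
by apply: e4 xu uv vy _ euy; rewrite e_sym.
Qed.

Lemma four_point_realization :
  and1_realization e (fun v => (order_rank (lo_nbr v))%:R : R)%R
    (fun v => (order_rank (hi_nbr v))%:R)%R (fun v => (order_rank v)%:R)%R.
Proof.
split=> [v|u v neq_uv]; rewrite !in_itv /= !ler_nat.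
  exact/in_nbr_hull/closed_nbr_refl.
split=> [euv|[/andP[lo_u hi_u] /andP[lo_v hi_v]]].
  by split; apply: in_nbr_hull; rewrite /closed_nbr ?(e_sym v) euv orbT.
(* The hull conditions are symmetric in [u] and [v], so either order of the two will do. *)
have [_ _ /(_ _ _ neq_uv)[uv|vu]] := lt_sto.
  exact: four_point_hull_adj.
by rewrite e_sym; exact: four_point_hull_adj.
Qed.

End RealizationOfOrder.

Theorem theorem2 (R : realType) (V : finType) (e : rel V)
    (e_sym : symmetric e) (e_irr : irreflexive e)
    (e_conn : connected_graph e) :
  in_And1 R e <->
  exists lt : rel V, strict_total_order lt /\ four_point_condition e lt.
Proof.
split=> [[lo [hi [p realP]]]|[lt [lt_sto e4]]].
  exists (fun u v => point_key p u < point_key p v)%O; split.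
    exact/key_strict_total_order/point_key_inj.
  exact: realization_four_point realP.
by do 3!eexists; exact: four_point_realization lt_sto e_sym e4.
Qed.
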